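(* Let $q\ge 2$ be an integer, let $T$ be the infinite homogeneous tree in which every vertex has exactly $q+1$ neighbours, and let $G(\cdot,\cdot)$ be the Green function of the simple random walk on $T$. Then $$G(a,x)=\frac{q}{q-1}\,q^{-d(a,x)}\qquad\text{for all } a,x\in T.$$
   Context: $T$ also denotes the vertex set of the tree; $d(a,x)$ is the number of edges of the geodesic path from $a$ to $x$. The simple random walk on $T$ is the Markov chain $(X_n)_{n\ge 0}$ with transition matrix $P=(p_{xy})_{x,y\in T}$, $p_{xy}=\frac{1}{q+1}$ if $y$ is a neighbour of $x$ and $p_{xy}=0$ otherwise; it is the reversible Markov chain associated with the electric network having conductance $1$ on every edge of $T$. The Green function is $$G(x,y)=\sum_{n\ge 0} (P^n)_{xy}=E_x\Big[\sum_{n\ge 0}\mathbf 1_{\{X_n=y\}}\Big],$$ where $P^0$ is the identity matrix and $E_x$ is expectation for the chain started at $x$. *)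

(* Defs.v *)
From HB Require Import structures.
From mathcomp Require Import all_boot all_order all_algebra.
From mathcomp Require Import all_classical all_reals all_analysis.

Set Implicit Arguments.
Unset Strict Implicit.
Unset Printing Implicit Defensive.

Import Order.TTheory GRing.Theory Num.Theory.

Local Open Scope classical_set_scope.
Local Open Scope ring_scope.

Record is_tree (T : choiceType) (e : rel T) : Prop := IsTree {
  tree_sym : symmetric e;
  tree_irrefl : irreflexive e;
  tree_connected : forall x y : T, exists p : seq T, path e x p /\ last x p = y;
  tree_acyclic : forall c : seq T, (2 < size c)%N -> ~ ucycle e c }.

Record is_homogeneous_tree (T : choiceType) (q : nat) (e : rel T) : Prop :=
  IsHomogeneousTree {
    htree_tree : is_tree e;
    htree_infinite : infinite_set [set: T];
    htree_degree : forall x : T, ([set y | e x y] #= `I_q.+1)%card }.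

(* The path is x :: p, so that size p is its number of edges. *)
Definition geodesic (T : choiceType) (e : rel T) (x y : T) (p : seq T) : Prop :=
  [/\ path e x p, last x p = y &
      forall p' : seq T, path e x p' -> last x p' = y -> (size p <= size p')%N].

(* The default value [::] is only reached if y is not connected to x. *)
Definition graph_dist (T : choiceType) (e : rel T) (x y : T) : nat :=
  size (xget [::] [set p | geodesic e x y p]).

Definition srw (R : realType) (T : choiceType) (q : nat) (e : rel T) (x y : T)
    : \bar R :=
  (if e x y then q.+1%:R^-1 else 0)%:E.

(* Powers of a matrix indexed by T. The entries of P must be nonnegative: esum
   is then the unconditional sum over T, with values in [0, +oo]. *)
Fixpoint kpow (R : realType) (T : choiceType) (P : T -> T -> \bar R)
    (n : nat) (x y : T) : \bar R :=
  if n is m.+1 then (\esum_(z in [set: T]) (P x z * kpow P m z y))%E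
  else (x == y)%:R%:E.

Definition green (R : realType) (T : choiceType) (P : T -> T -> \bar R)
    (x y : T) : \bar R :=
  (\sum_(0 <= n <oo) kpow P n x y)%E.

(* Main.v *)
(** Fix [x] and let [D] be the distance to [x]. A vertex [y <> x] has exactly
    one neighbour with [D = D y - 1] and [q] neighbours with [D = D y + 1], so
    the walk acts on functions of [D] by an operator [L] on sequences, and
    [(P^n)_{yx} = (L^n delta_0)(D y)]. The claimed value
    [h d = q / (q - 1) * q ^- d] solves [h - L h = delta_0], hence
    [h - \sum_(k < n) L^k delta_0 = L^n h]. The remainder vanishes in the limit:
    [d |-> r ^ d] satisfies [L (r ^ d) <= lam * r ^ d] with
    [lam = (q r + 1 / r) / (q + 1) < 1] as soon as [1 / q < r < 1]; below,
    [r = 2 / (q + 1)]. *)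
Require Import Defs.
From HB Require Import structures.
From mathcomp Require Import all_boot all_order all_algebra.
From mathcomp Require Import all_classical all_reals all_analysis.
From mathcomp Require Import ring lra.

Set Implicit Arguments.
Unset Strict Implicit.
Unset Printing Implicit Defensive.

Import Order.TTheory GRing.Theory Num.Theory.
Import numFieldNormedType.Exports.

Local Open Scope classical_set_scope.
Local Open Scope ring_scope.

(** * Distance to a fixed vertex of a tree *)

Lemma tree_neighbors_separated (T : choiceType) (e : rel T) (y z1 z2 : T)
    (p : seq T) :
  is_tree e -> e y z1 -> e y z2 -> path e z1 p -> last z1 p = z2 ->
  y \notin z1 :: p -> z1 = z2.
Proof.
move=> eT yz1 yz2 ep; case/shortenP: ep => p' ep' up' sub lp yNp.
have yNp' : y \notin z1 :: p'.
  apply: contra yNp; rewrite !inE => /orP[->//|yp'].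
  by rewrite (sub _ yp') orbT.
case: p' ep' up' sub lp yNp' => [//|w p'] ep' up' sub lp yNp'.
(* The shortened path still avoids [y] and has at least two vertices, so [y] closes it to a cycle of
   length at least 3. *)
have /= := tree_acyclic eT (c := [:: y, z1, w & p']) erefl; case.
rewrite /ucycle; apply/andP; split; last by rewrite cons_uniq yNp' up'.
rewrite (cycle_path y) [last _ _]/= -[last w p']/(last z1 (w :: p')) lp.
by rewrite /= (tree_sym eT) yz2 yz1.
Qed.

Section GraphDist.

Variables (T : choiceType) (e : rel T) (eT : is_tree e).

Lemma geodesic_exists (y x : T) : exists p, geodesic e y x p.
Proof.
have [p0 [ep0 lp0]] := tree_connected eT y x.
pose P n := `[< exists p, [/\ path e y p, last y p = x & size p = n] >].
have exP : exists n, P n by exists (size p0); apply/asboolP; exists p0.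
case: (ex_minnP exP) => n /asboolP[p [ep lp sp]] nmin.
exists p; split=> // p' ep' lp'; rewrite sp; apply: nmin.
by apply/asboolP; exists p'.
Qed.

(** Connectedness rules out the default value in [graph_dist]. *)
Lemma graph_dist_geodesic (y x : T) :
  exists2 p, geodesic e y x p & size p = graph_dist e y x.
Proof.
have [p gp] := geodesic_exists y x.
exists (xget [::] [set p | geodesic e y x p]) => //.
exact: (@xgetI _ _ [set p | geodesic e y x p] p).
Qed.

Lemma graph_dist_le (y x : T) (p : seq T) :
  path e y p -> last y p = x -> (graph_dist e y x <= size p)%N.
Proof.
by move=> ep lp; have [p' [_ _ + <-]] := graph_dist_geodesic y x; apply.
Qed.

Lemma graph_distxx (x : T) : graph_dist e x x = 0.
Proof. by apply/eqP; rewrite -leqn0; exact: (@graph_dist_le x x [::]). Qed.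

Lemma graph_dist_eq0 (y x : T) : (graph_dist e y x == 0) = (y == x).
Proof.
apply/eqP/eqP => [|->]; last exact: graph_distxx.
by have [p [_ <- _] <-] := graph_dist_geodesic y x => /size0nil ->.
Qed.

Lemma graph_dist_edge (y z x : T) :
  e y z -> (graph_dist e y x <= (graph_dist e z x).+1)%N.
Proof.
move=> yz; have [p [ep lp _] <-] := graph_dist_geodesic z x.
by apply: (@graph_dist_le _ _ (z :: p)) => //=; rewrite yz.
Qed.

Lemma graph_dist_parent (y x : T) :
  y != x -> exists2 z, e y z & graph_dist e y x = (graph_dist e z x).+1.
Proof.
move=> yx; have [[|z p] [/= ep lp _] sp] := graph_dist_geodesic y x.
  by rewrite lp eqxx in yx.
case/andP: ep => yz ep; exists z => //; apply/eqP.
rewrite eqn_leq graph_dist_edge//= -sp ltnS.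
exact: graph_dist_le.
Qed.

(** The portion of the path beyond [v] still leads to [x]; the inequality is strict because [v]
    comes after at least one edge. *)
Lemma geodesic_tail (z x v : T) (p : seq T) :
  geodesic e z x p -> v \in p -> (graph_dist e v x < size p)%N.
Proof.
move=> [ep lp _] vp; case/splitPr: vp ep lp => p1 p2.
rewrite cat_path last_cat /= => /and3P[_ _ ep2] lp2.
rewrite size_cat /= addnS ltnS; apply: (@leq_trans (size p2)).
  exact: graph_dist_le.
exact: leq_addl.
Qed.

(* Two geodesics to [x] from neighbours of [y] that are no farther from [x]
   than [y] avoid [y], so together with [y] they would close a cycle. *)
Lemma graph_dist_parent_uniq (y z1 z2 x : T) :
  e y z1 -> e y z2 ->
  (graph_dist e z1 x <= graph_dist e y x)%N ->
  (graph_dist e z2 x <= graph_dist e y x)%N -> z1 = z2.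
Proof.
have avoid z p : e y z -> (graph_dist e z x <= graph_dist e y x)%N ->
    geodesic e z x p -> size p = graph_dist e z x -> y \notin z :: p.
  move=> yz dz gp sp; rewrite inE negb_or; apply/andP; split.
    by apply/eqP => yz'; rewrite -yz' (tree_irrefl eT) in yz.
  apply/negP => /(geodesic_tail gp); rewrite sp => /leq_trans/(_ dz).
  by rewrite ltnn.
move=> yz1 yz2 d1 d2.
have [p1 g1 s1] := graph_dist_geodesic z1 x.
have [p2 g2 s2] := graph_dist_geodesic z2 x.
have := avoid _ _ yz1 d1 g1 s1; have := avoid _ _ yz2 d2 g2 s2.
case: g1 g2 => ep1 lp1 _ [ep2 lp2 _] yN2 yN1.
have ep2r : path e x (rev (belast z2 p2)).
  rewrite -lp2 rev_path; apply: sub_path ep2 => u v.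
  by rewrite /= (tree_sym eT).
apply: (@tree_neighbors_separated T e y z1 z2 (p1 ++ rev (belast z2 p2))) => //.
- by rewrite cat_path ep1 lp1.
- rewrite last_cat lp1; case: p2 {s2 ep2 yN2 ep2r} lp2 => [/= ->//|w p2] _.
  by rewrite /= rev_cons last_rcons.
- rewrite -cat_cons mem_cat negb_or yN1 mem_rev /=.
  by apply: contra yN2 => /mem_belast.
Qed.

End GraphDist.

(** * The radial operator [L] and its Green function *)

Section RadialStep.

Variables (R : realType) (q : nat).

(* The transition operator acting on functions of the distance to a vertex. *)
Definition radial_step (F : nat -> R) (d : nat) : R :=
  if d is d'.+1 then (F d' + q%:R * F d'.+2) / q.+1%:R else F 1%N.

Definition radial_delta (d : nat) : R := (d == 0)%:R.

Lemma radial_step_ge0 (F : nat -> R) :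
  (forall d, 0 <= F d) -> forall d, 0 <= radial_step F d.
Proof.
move=> F0 [|d] /=; first exact: F0.
by rewrite divr_ge0// addr_ge0// mulr_ge0.
Qed.

Lemma radial_iter_ge0 n d : 0 <= iter n radial_step radial_delta d.
Proof.
elim: n d => [|n IH] d; first by rewrite /= /radial_delta ler0n.
exact: radial_step_ge0.
Qed.

(** Linearity of [L^n]. Applied to [h - L h = delta_0], it writes [L^n delta_0] as
    [L^n h - L^(n+1) h], so the partial sums telescope. *)
Lemma radial_iterB (A B C : nat -> R) :
  (forall d, A d - B d = C d) ->
  forall n d, iter n radial_step A d - iter n radial_step B d
              = iter n radial_step C d.
Proof.
move=> ABC; elim=> [|n IH] d //=.
case: d => [|d] /=; first exact: IH.
by rewrite -!IH -mulrBl; congr (_ / _); ring.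
Qed.

Hypothesis hq : (2 <= q)%N.

Let natr_q_ge2 : 2 <= q%:R :> R. Proof. by rewrite ler_nat. Qed.

Definition radial_green (d : nat) : R := q%:R / (q%:R - 1) * q%:R ^- d.

Lemma radial_green_step d :
  radial_green d - radial_step radial_green d = radial_delta d.
Proof.
have q2 := natr_q_ge2.
have q0 : q%:R != 0 :> R by rewrite pnatr_eq0 -lt0n ltnW.
have q1 : q%:R - 1 != 0 :> R by apply: lt0r_neq0; lra.
have q3 : 1 + q%:R != 0 :> R by apply: lt0r_neq0; lra.
rewrite /radial_green /radial_delta; case: d => [|d] /=.
  by rewrite expr0 expr1; field; rewrite q0 q1.
have qd : q%:R ^+ d != 0 :> R by rewrite expf_neq0.
by rewrite !exprS -natr1; field; rewrite q0 q1 qd addrC q3.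
Qed.

Lemma radial_green_partial n d :
  radial_green d - \sum_(0 <= k < n) iter k radial_step radial_delta d
  = iter n radial_step radial_green d.
Proof.
elim: n => [|n IH]; first by rewrite big_nil subr0.
rewrite big_nat_recr//= opprD addrA IH -(radial_iterB radial_green_step).
by rewrite -iterSr opprB addrC subrK.
Qed.

(** For positive [r], [lam < 1] amounts to [(q r - 1) (r - 1) < 0]; the choice made here is the
    harmonic mean of the roots [1 / q] and [1]. *)
Let r : R := 2 / q.+1%:R.
Let lam : R := (q%:R * r + r^-1) / q.+1%:R.

Let qS : q.+1%:R = q%:R + 1 :> R. Proof. by rewrite -natr1. Qed.

Let r0 : 0 < r. Proof. by rewrite divr_gt0. Qed.

Let rq : q%:R^-1 <= r.
Proof.
have q2 := natr_q_ge2.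
rewrite /r qS -[leLHS]div1r ler_pdivrMr; last lra.
by rewrite mulrAC ler_pdivlMr; lra.
Qed.

Let lamE : lam = (4 * q%:R + (q%:R + 1) ^+ 2) / (2 * (q%:R + 1) ^+ 2).
Proof.
have q2 := natr_q_ge2.
have q3 : q%:R + 1 != 0 :> R by apply: lt0r_neq0; lra.
by rewrite /lam /r qS; field.
Qed.

(** From distance 0 the walk always moves to distance 1, so [L (r ^ d) <= lam * r ^ d] reads
    [r <= lam] there; for [d > 0] it is an equality. *)
Let r_lam : r <= lam.
Proof.
have q2 := natr_q_ge2.
have q3 : 0 < q%:R + 1 :> R by lra.
rewrite lamE ler_pdivlMr ?mulr_gt0 ?exprn_gt0// /r qS.
have -> : 2 / (q%:R + 1) * (2 * (q%:R + 1) ^+ 2) = 4 * (q%:R + 1) :> R.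
  by field; apply: lt0r_neq0.
by nra.
Qed.

Let lam1 : lam < 1.
Proof.
have q2 := natr_q_ge2.
have q3 : 0 < q%:R + 1 :> R by lra.
(* With denominators cleared, this is [(q - 1) ^ 2 > 0]. *)
by rewrite lamE ltr_pdivrMr ?mulr_gt0 ?exprn_gt0//; nra.
Qed.

Lemma radial_iter_bound (F : nat -> R) (K : R) :
  (forall d, `|F d| <= K * r ^+ d) ->
  forall n d, `|iter n radial_step F d| <= K * lam ^+ n * r ^+ d.
Proof.
move=> F0; have lam0 : 0 <= lam by rewrite (le_trans _ r_lam)// ltW.
have K0 : 0 <= K by have := F0 0%N; rewrite expr0 mulr1; exact: le_trans.
elim=> [|n IH] d; first by rewrite expr0 mulr1.
set M := K * lam ^+ n in IH; have M0 : 0 <= M by rewrite mulr_ge0// exprn_ge0.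
rewrite exprSr mulrA -/M; case: d => [|d] /=.
  by rewrite expr0 mulr1 (le_trans (IH 1%N))// expr1 ler_wpM2l.
have -> : M * lam * r ^+ d.+1 =
    (M * r ^+ d + q%:R * (M * r ^+ d.+2)) / q.+1%:R.
  have rn : r != 0 by exact: lt0r_neq0.
  by rewrite /lam !exprS; field; rewrite rn ?andbT addrC -?qS pnatr_eq0.
rewrite normrM [`|_^-1|]ger0_norm// ler_wpM2r//.
rewrite (le_trans (ler_normD _ _))// lerD//.
by rewrite normrM ger0_norm// ler_wpM2l.
Qed.

(** Comparing [h] with its own rate [q ^- d] would give the factor 1 per step for [d > 0]; the
    larger weight [r ^ d] gains a factor [lam < 1]. *)
Lemma radial_iter_green_cvg0 d :
  (fun n => iter n radial_step radial_green d) @ \oo --> (0 : R).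
Proof.
have q2 := natr_q_ge2.
have c0 : 0 <= q%:R / (q%:R - 1) :> R by rewrite divr_ge0//; lra.
have lam0 : 0 <= lam by rewrite (le_trans _ r_lam)// ltW.
have F0 k : `|radial_green k| <= q%:R / (q%:R - 1) * r ^+ k.
  rewrite ger0_norm /radial_green; last first.
    by rewrite mulr_ge0// invr_ge0 exprn_ge0.
  by rewrite ler_wpM2l// -exprVn lerXn2r ?nnegrE ?invr_ge0// ltW.
apply: norm_cvg0; apply: (@squeeze_cvgr _ _ _ _ (cst 0)
  (geometric (q%:R / (q%:R - 1) * r ^+ d) lam)).
- near=> n; rewrite /cst normr_ge0 /= (le_trans (radial_iter_bound F0 n d))//.
  by rewrite mulrAC.
- exact: cvg_cst.
- by apply: cvg_geometric; rewrite ger0_norm.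
Unshelve. all: by end_near. Qed.

End RadialStep.

(** * Reduction of the walk to the radial operator *)

Lemma esum_srw (R : realType) (T : choiceType) (q : nat) (e : rel T) (y : T)
    (s : seq T) (g : T -> R) :
  uniq s -> (forall z, (z \in s) = e y z) -> (forall z, 0 <= g z) ->
  (\esum_(z in [set: T]) (srw R q e y z * (g z)%:E))%E
  = (q.+1%:R^-1 * \sum_(z <- s) g z)%:E.
Proof.
move=> us mem g0.
transitivity (\esum_(z in [set` s]) (q.+1%:R^-1 * g z)%:E)%E.
  rewrite [RHS]esum_mkcond; apply: eq_esum => z _.
  rewrite /srw mem_setE mem; case: ifP => _; first by rewrite EFinM.
  by rewrite mul0e.
rewrite esum_fset//; last by move=> z _; rewrite lee_fin mulr_ge0// invr_ge0.
by rewrite -fsbig_seq// sumEFin mulr_sumr.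
Qed.

Section RadialWalk.

Variables (R : realType) (q : nat) (T : choiceType) (e : rel T).
Hypothesis hT : is_homogeneous_tree q e.

Let eT := htree_tree hT.

Lemma srw_radial (x y : T) (F : nat -> R) : (forall d, 0 <= F d) ->
  (\esum_(z in [set: T]) (srw R q e y z * (F (graph_dist e z x))%:E))%E
  = (radial_step q F (graph_dist e y x))%:E.
Proof.
move=> F0.
have fin : finite_set [set z | e y z].
  by apply/finite_setP; exists q.+1; exact: htree_degree.
pose s : seq T := finmap.enum_fset (fset_set [set z | e y z]).
have us : uniq s := finmap.fset_uniq _.
have ss : size s = q.+1 := card_fset_set (htree_degree hT y).
have mem z : (z \in s) = e y z by rewrite [LHS](in_fset_set fin) mem_setE.
rewrite (esum_srw q us mem)//; congr EFin.
have [xy|yx] := eqVneq y x.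
  rewrite -xy (graph_distxx eT) /= (@eq_big_seq _ _ _ _ _ _ (fun=> F 1%N)).
    rewrite big_const_seq count_predT ss iter_addr_0.
    by rewrite -[F _ *+ _]mulr_natl mulKf.
  move=> z; rewrite mem => yz; congr F; apply/eqP.
  have zy : z != y by apply/eqP => zy; rewrite zy (tree_irrefl eT) in yz.
  rewrite eqn_leq lt0n graph_dist_eq0// zy andbT.
  have := @graph_dist_edge _ _ eT z y y; rewrite (graph_distxx eT); apply.
  by rewrite (tree_sym eT).
have [p yp dp] := graph_dist_parent eT yx.
rewrite (perm_big _ (perm_to_rem (_ : p \in s))) ?mem//= big_cons dp /=.
rewrite (@eq_big_seq _ _ _ _ _ _ (fun=> F (graph_dist e p x).+2)).
  rewrite big_const_seq count_predT size_rem ?mem// ss iter_addr_0.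
  by rewrite -[F _ *+ _]mulr_natl mulrC.
move=> z; rewrite mem_rem_uniq// inE mem => /andP[zp yz]; congr F.
apply/eqP; rewrite eqn_leq -dp; apply/andP; split.
  by rewrite graph_dist_edge// (tree_sym eT).
(* A neighbour of [y] no farther from [x] than [y] must be the parent [p], which also excludes equal
   distances. *)
rewrite ltnNge; apply: contra zp => dz; apply/eqP.
by apply: (graph_dist_parent_uniq eT yz yp dz); rewrite dp.
Qed.

(** [kpow] expands along the first step, so the target [x] stays fixed while the induction varies
    the starting vertex. *)
Lemma kpow_radial (n : nat) (x y : T) :
  kpow (srw R q e) n y x
  = (iter n (radial_step q) (@radial_delta R) (graph_dist e y x))%:E.
Proof.
elim: n y => [|n IH] y /=; first by rewrite /radial_delta graph_dist_eq0.
under eq_esum do rewrite IH.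
by apply: srw_radial => d; exact: radial_iter_ge0.
Qed.

End RadialWalk.

Theorem corollary7p2 (R : realType) (q : nat) (T : choiceType) (e : rel T)
    (hq : (2 <= q)%N) (hT : is_homogeneous_tree q e) (a x : T) :
  green (srw R q e) a x = (q%:R / (q%:R - 1) * q%:R ^- graph_dist e a x)%:E.
Proof.
rewrite -[_ / _ * _]/(radial_green R q (graph_dist e a x)).
apply/cvg_lim => //; set d := graph_dist e a x.
(* The partial sums become the finite reals [h d - (L^n h) d], leaving only the remainder to
   vanish. *)
have -> : (fun n => \sum_(0 <= k < n) kpow (srw R q e) k a x)%E =
    EFin \o (fun n => radial_green R q d
                      - iter n (radial_step q) (@radial_green R q) d).
  apply/funext => n /=; rewrite -radial_green_partial// subKr -sumEFin.
  by apply: eq_bigr => k _; exact: kpow_radial.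
apply: cvg_EFin; first exact: nearW.
rewrite -[X in _ --> X]subr0; apply: cvgB; first exact: cvg_cst.
exact: radial_iter_green_cvg0.
Qed.
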